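(* Let $(\mathcal{M},\varphi,\xi,\eta,g)$ be a 5-dimensional elliptic ($\sigma=1$) or hyperbolic ($\sigma=-1$) weakly para-cosymplectic manifold with para-K\''ahler leaves, let $(V_0=\xi,V_1,V_2,V_3,V_4)$ be a local adopted frame, $\theta^i=g(\cdot,V_i)$ its metric-dual coframe and $\tau_1,\tau_2,\omega$ the associated 1-forms. With $\varTheta^{ij}=2\theta^i\wedge\theta^j$ and $D\omega=d\omega-\omega\wedge(\tau_1+\tau_2)$, the Riemann-Christoffel curvature is $$R(X,Y,Z,W)=g(AX,Z)g(AY,W)-g(AY,Z)g(AX,W)-2d\tau_1(X,Y)\varTheta^{13}(Z,W)-2d\tau_2(X,Y)\varTheta^{24}(Z,W)+2D\omega(X,Y)\varTheta^{12}(Z,W),$$ and the forms satisfy $$d\tau_1\wedge\theta^1=0,\quad d\tau_2\wedge\theta^2=0,\quad d\tau_1\wedge\theta^3=D\omega\wedge\theta^2,\quad d\tau_2\wedge\theta^4=-D\omega\wedge\theta^1.$$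
   Context: All manifolds, tensor fields and functions are smooth. An almost para-contact metric structure on $\mathcal{M}$, $\dim\mathcal{M}=2n+1$, is a quadruple $(\varphi,\xi,\eta,g)$ ($\varphi$ a $(1,1)$-tensor field, $\xi$ a vector field, $\eta$ a 1-form, $g$ a pseudo-Riemannian metric) with $\varphi^2=Id-\eta\otimes\xi$, $\eta(\xi)=1$, $g(\varphi X,\varphi Y)=-g(X,Y)+\eta(X)\eta(Y)$, $\eta(X)=g(\xi,X)$. With $\varPhi(X,Y)=g(\varphi X,Y)$, the manifold is almost para-cosymplectic if $d\eta=0$ and $d\varPhi=0$; it is then weakly para-cosymplectic if $R(X,Y)\varphi Z=\varphi R(X,Y)Z$ for all $X,Y,Z$, where $R(X,Y)Z=\nabla_X\nabla_YZ-\nabla_Y\nabla_XZ-\nabla_{[X,Y]}Z$ and $\nabla$ is the Levi-Civita connection. $R(X,Y,Z,W)=g(R(X,Y)Z,W)$. Put $AX=-\nabla_X\xi$. Each leaf of the foliation $\eta=0$ inherits an almost para-Hermitian structure $(P,H)$ by restricting $\varphi$ and $g$; the manifold has para-K\''ahler leaves if $P$ is parallel for the Levi-Civita connection of $H$ on every leaf, equivalently $(\nabla_X\varphi)Y=g(A\varphi X,Y)\xi-\eta(Y)A\varphi X$. Elliptic/hyperbolic (dimension 5): near each point there are smooth nowhere zero vector fields $V_1,V_2$ (unique up to sign) with $\varphi V_1=-V_1$, $\varphi V_2=V_2$, $g(V_1,V_2)=0$ and $AX=\varepsilon\left(g(X,V_1)V_1+\sigma g(X,V_2)V_2\right)$,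 $\varepsilon=\pm1$, where $\sigma=1$ in the elliptic and $\sigma=-1$ in the hyperbolic case. Replacing $(\xi,\eta)$ by $(-\xi,-\eta)$ if necessary, it is always assumed that $\varepsilon=1$. An adopted frame is a local frame $(V_0=\xi,V_1,V_2,V_3,V_4)$ extending $(\xi,V_1,V_2)$ with $\varphi V_3=V_3$, $\varphi V_4=-V_4$ and such that the only non-zero coefficients of the metric are $g(\xi,\xi)=g(V_1,V_3)=g(V_2,V_4)=1$ (and the symmetric ones). The associated 1-forms $\tau_1,\tau_2,\omega$ are determined by $\nabla_XV_1=\tau_1(X)V_1$, $\nabla_XV_2=\tau_2(X)V_2$, $\omega(X)=g(\nabla_XV_3,V_4)$; moreover $\tau_1$ is a multiple of $\theta^1$, $\tau_2$ is a multiple of $\theta^2$, $\nabla_XV_3=\theta^1(X)\xi+\omega(X)V_2-\tau_1(X)V_3$ and $\nabla_XV_4=\sigma\theta^2(X)\xi-\omega(X)V_1-\tau_2(X)V_4$. Conventions for 1-forms: $(\alpha\wedge\beta)(X,Y)=\frac12(\alpha(X)\beta(Y)-\alpha(Y)\beta(X))$, $2d\alpha(X,Y)=X\alpha(Y)-Y\alpha(X)-\alpha([X,Y])$. *)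

(* Defs.v *)
(* Smooth manifolds are given by atlases on topological spaces, tangent vectors
   are derivations of germs of smooth functions, and vector fields and tensor
   fields are sections defined everywhere on the manifold whose values only
   matter on the open set under consideration (e.g. the domain of a frame). *)
From HB Require Import structures.
From mathcomp Require Import all_boot all_order all_algebra.
From mathcomp Require Import all_classical all_reals all_analysis.
Set Implicit Arguments.
Unset Strict Implicit.
Unset Printing Implicit Defensive.
Import Order.TTheory GRing.Theory Num.Theory.
Import numFieldNormedType.Exports.
Local Open Scope classical_set_scope.
Local Open Scope ring_scope.

Section SmoothFunctions.
Context {R : realType} {n : nat}.

Fixpoint Cn (k : nat) (A : set 'rV[R]_n) (f : 'rV[R]_n -> R) : Prop :=
  (forall x, A x -> {for x, continuous f}) /\
  if k is k'.+1 then
    forall i : 'I_n, (forall x, A x -> derivable f x (delta_mx 0 i)) /\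
                     Cn k' A (fun x => 'D_(delta_mx 0 i) f x)
  else True.

Definition Cinfty (A : set 'rV[R]_n) (f : 'rV[R]_n -> R) : Prop :=
  forall k, Cn k A f.

End SmoothFunctions.

(* A homeomorphism, with its inverse, from an open subset of T onto an open
   subset of R^n; both maps take arbitrary values elsewhere. *)
Record chart (R : realType) (n : nat) (T : topologicalType) := Chart {
  cdom : set T;
  cmap : T -> 'rV[R]_n;
  cinv : 'rV[R]_n -> T;
  cdom_open : open cdom;
  cimg_open : open (cmap @` cdom);
  cmapK : forall p, cdom p -> cinv (cmap p) = p;
  cmap_continuous : forall p, cdom p -> {for p, continuous cmap};
  cinv_continuous : forall x, (cmap @` cdom) x -> {for x, continuous cinv}
}.

Definition smooth_transition (R : realType) (n : nat) (T : topologicalType)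
    (c1 c2 : chart R n T) : Prop :=
  forall i : 'I_n, Cinfty (cmap c1 @` (cdom c1 `&` cdom c2))
                          (fun x => cmap c2 (cinv c1 x) 0 i).

Record smoothManifold (R : realType) (n : nat) := SmoothManifold {
  carrier :> topologicalType;
  atlas : set (chart R n carrier);
  _ : hausdorff_space carrier;
  _ : @second_countable carrier;
  _ : forall p, exists2 c, atlas c & cdom c p;
  _ : forall c1 c2, atlas c1 -> atlas c2 -> smooth_transition c1 c2
}.

(* f is smooth on some open neighbourhood W of p. *)
Definition smooth_at (R : realType) (n : nat) (M : smoothManifold R n)
    (f : M -> R) (p : M) : Prop :=
  exists2 W : set M, open W /\ W p &
    forall c, atlas c -> Cinfty (cmap c @` (W `&` cdom c)) (f \o cinv c).

Section TangentSpace.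
Context {R : realType} {n : nat} (M : smoothManifold R n) (p : M).

(* The first condition is only a normalisation: an element of the tangent space
   is determined by its values on the functions that are smooth near p. *)
Definition derivation_at (v : (M -> R) -> R^o) : Prop :=
  [/\ forall f, ~ smooth_at f p -> v f = 0,
      forall f h, smooth_at f p -> smooth_at h p ->
        (\forall q \near p, f q = h q) -> v f = v h,
      forall (a : R) f h, smooth_at f p -> smooth_at h p ->
        v (fun q => a * f q + h q) = a * v f + v h &
      forall f h, smooth_at f p -> smooth_at h p ->
        v (fun q => f q * h q) = v f * h p + f p * v h].

Definition derivation_pred : {pred ((M -> R) -> R^o)} :=
  fun v => `[< derivation_at v >].

Lemma derivation_submod : submod_closed derivation_pred.
Proof.
split=> [|a u v].
  apply/asboolP; split=> //= *; rewrite /GRing.zero /=; by rewrite ?mulr0 ?mul0r ?addr0.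
move=> /asboolP[u0 uE uD uM] /asboolP[v0 vE vD vM]; apply/asboolP.
have E f : (a *: u + v) f = a * u f + v f by [].
split=> [f nf|f h sf sh fh|b f h sf sh|f h sf sh]; rewrite !E.
- by rewrite u0// v0// mulr0 addr0.
- by rewrite (uE f h)// (vE f h).
- rewrite uD// vD// !mulrDr !mulrA (mulrC a b) -!addrA; congr (_ + _).
  by rewrite addrCA.
- rewrite uM// vM// !mulrDr !mulrDl !mulrA (mulrC (f p) a) -!addrA.
  by congr (_ + _); rewrite addrCA.
Qed.

HB.instance Definition _ :=
  GRing.isSubmodClosed.Build R ((M -> R) -> R^o) derivation_pred derivation_submod.

Record tangent := Tangent {
  tangent_val :> (M -> R) -> R^o;
  _ : tangent_val \in derivation_pred
}.

HB.instance Definition _ := [isSub for tangent_val].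
HB.instance Definition _ := [Choice of tangent by <:].
HB.instance Definition _ := [SubChoice_isSubLmodule of tangent by <:].

(* The tangent vector acting as D on functions smooth near p (and 0 if D does
   not act as a derivation on those). *)
Definition to_tangent (D : (M -> R) -> R) : tangent :=
  insubd 0 (fun f => if `[< smooth_at f p >] then D f else 0).

End TangentSpace.
Arguments to_tangent {R n M} p D.

Section TensorFields.
Context {R : realType} {n : nat} (M : smoothManifold R n).

Definition vfield := forall p : M, tangent p.
Definition endofield := forall p : M, {linear tangent p -> tangent p}.
Definition oneform := forall p : M, {scalar tangent p}.
Definition bilinfield := forall p : M, tangent p -> {scalar tangent p}.
End TensorFields.

Section Smoothness.
Context {R : realType} {n : nat} {M : smoothManifold R n}.
Implicit Types (X Y Z : vfield M) (p : M).

Definition vsmooth_at X p : Prop :=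
  \forall q \near p, forall f, smooth_at f q -> smooth_at (fun r => X r f) q.

Definition endo_smooth (F : endofield M) : Prop :=
  forall p X, vsmooth_at X p -> vsmooth_at (fun q => F q (X q)) p.

Definition oneform_smooth_on (U : set M) (a : oneform M) : Prop :=
  forall p X, U p -> vsmooth_at X p -> smooth_at (fun q => a q (X q)) p.

Definition bilin_smooth (g : bilinfield M) : Prop :=
  forall p X Y, vsmooth_at X p -> vsmooth_at Y p ->
    smooth_at (fun q => g q (X q) (Y q)) p.

Definition lie X Y : vfield M := fun p =>
  to_tangent p (fun f => X p (fun q => Y q f) - Y p (fun q => X q f)).

(* Differential forms are evaluated on vector fields. The normalisation is
   2 (da)(X, Y) = X a(Y) - Y a(X) - a([X, Y]), 3 (dF)(X, Y, Z) = cyclic sum of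
   X F(Y, Z) - F([X, Y], Z), and the wedge product is the alternation of the
   tensor product (with the factor 1/2 for two 1-forms and 1/3 for the cyclic
   sum in the product of a 2-form and a 1-form). *)
Definition twoform := vfield M -> vfield M -> M -> R.
Definition threeform := vfield M -> vfield M -> vfield M -> M -> R.

Definition d1 (a : oneform M) : twoform := fun X Y p =>
  2^-1 * (X p (fun q => a q (Y q)) - Y p (fun q => a q (X q)) - a p (lie X Y p)).

Definition d2 (F : twoform) : threeform := fun X Y Z p =>
  3^-1 * (X p (F Y Z) + Y p (F Z X) + Z p (F X Y)
          - F (lie X Y) Z p - F (lie Y Z) X p - F (lie Z X) Y p).

Definition wedge11 (a b : oneform M) : twoform := fun X Y p =>
  2^-1 * (a p (X p) * b p (Y p) - a p (Y p) * b p (X p)).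

Definition wedge21 (F : twoform) (b : oneform M) : threeform := fun X Y Z p =>
  3^-1 * (F X Y p * b p (Z p) + F Y Z p * b p (X p) + F Z X p * b p (Y p)).

Definition add_oneform (a b : oneform M) : oneform M := fun p => a p \+ b p.

End Smoothness.

Section Metric.
Context {R : realType} {n : nat} {M : smoothManifold R n}.
Implicit Types (X Y Z : vfield M) (p : M) (g : bilinfield M).

Definition pseudo_riemannian g : Prop :=
  [/\ bilin_smooth g,
      forall p (v w : tangent p), g p v w = g p w v &
      forall p (v : tangent p), (forall w, g p v w = 0) -> v = 0].

Definition connection := vfield M -> vfield M -> vfield M.

(* Read at a point p, for vector fields that are smooth near p. *)
Definition affine_connection (nabla : connection) : Prop :=
  [/\ forall p X Y, vsmooth_at X p -> vsmooth_at Y p -> vsmooth_at (nabla X Y) p,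
      forall p X X' Y Y', vsmooth_at X p -> vsmooth_at Y p ->
        (\forall q \near p, X q = X' q) -> (\forall q \near p, Y q = Y' q) ->
        nabla X Y p = nabla X' Y' p,
      forall p f X X' Y, smooth_at f p ->
        vsmooth_at X p -> vsmooth_at X' p -> vsmooth_at Y p ->
        nabla (fun q => f q *: X q + X' q) Y p = f p *: nabla X Y p + nabla X' Y p &
      forall p f X Y Y', smooth_at f p ->
        vsmooth_at X p -> vsmooth_at Y p -> vsmooth_at Y' p ->
        nabla X (fun q => f q *: Y q + Y' q) p =
          X p f *: Y p + f p *: nabla X Y p + nabla X Y' p].

Definition levi_civita g (nabla : connection) : Prop :=
  [/\ affine_connection nabla,
      forall p X Y, vsmooth_at X p -> vsmooth_at Y p ->
        nabla X Y p - nabla Y X p = lie X Y p &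
      forall p X Y Z, vsmooth_at X p -> vsmooth_at Y p -> vsmooth_at Z p ->
        X p (fun q => g q (Y q) (Z q)) =
          g p (nabla X Y p) (Z p) + g p (Y p) (nabla X Z p)].

Definition curvature (nabla : connection) X Y Z : vfield M := fun p =>
  nabla X (nabla Y Z) p - nabla Y (nabla X Z) p - nabla (lie X Y) Z p.

Definition parallel_endo (nabla : connection) (F : endofield M) : Prop :=
  forall p X Y, vsmooth_at X p -> vsmooth_at Y p ->
    nabla X (fun q => F q (Y q)) p = F p (nabla X Y p).

End Metric.

Section Submanifold.
Context {R : realType} {m n : nat}.

Definition smooth_map (N : smoothManifold R m) (M : smoothManifold R n)
    (i : N -> M) : Prop :=
  continuous i /\
  forall q (f : M -> R), smooth_at f (i q) -> smooth_at (f \o i) q.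

Definition tmap (N : smoothManifold R m) (M : smoothManifold R n)
    (i : N -> M) (q : N) (v : tangent q) : tangent (i q) :=
  to_tangent (i q) (fun f => v (f \o i)).

(* Connected immersed integral manifolds of the distribution eta = 0. *)
Definition integral_manifold (M : smoothManifold R n) (eta : oneform M)
    (N : smoothManifold R m) (i : N -> M) : Prop :=
  [/\ connected [set: N], smooth_map i, injective i,
      forall q, injective (@tmap N M i q) &
      forall q (w : tangent (i q)),
        eta (i q) w = 0 <-> exists v : tangent q, tmap i v = w].

Definition leaf (M : smoothManifold R n) (eta : oneform M)
    (N : smoothManifold R m) (i : N -> M) : Prop :=
  integral_manifold eta i /\
  forall (N' : smoothManifold R m) (i' : N' -> M), integral_manifold eta i' ->
    range i `<=` range i' -> range i' = range i.

End Submanifold.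

Section ParaContact.
Context {R : realType} {k : nat} {M : smoothManifold R k.+1}.
Local Unset Implicit Arguments.
Variables (phi : endofield M) (xi : vfield M) (eta : oneform M) (g : bilinfield M).
Variable nabla : connection (M := M).
Local Set Implicit Arguments.

(* These identities force k to be even and the signature of g to be
   (k/2 + 1, k/2). *)
Definition almost_para_contact_metric : Prop :=
  [/\ endo_smooth phi /\ (forall p : M, vsmooth_at xi p),
      oneform_smooth_on setT eta /\ pseudo_riemannian g,
      forall (p : M) (v : tangent p), phi p (phi p v) = v - eta p v *: xi p,
      forall p : M, eta p (xi p) = 1 &
      forall (p : M) (v w : tangent p),
        g p (phi p v) (phi p w) = - g p v w + eta p v * eta p w /\
        eta p v = g p (xi p) v].

Definition fundamental_form : twoform :=
  fun X Y p => g p (phi p (X p)) (Y p).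

Definition almost_para_cosymplectic : Prop :=
  [/\ almost_para_contact_metric,
      forall p X Y, vsmooth_at X p -> vsmooth_at Y p -> d1 eta X Y p = 0 &
      forall p X Y Z, vsmooth_at X p -> vsmooth_at Y p -> vsmooth_at Z p ->
        d2 fundamental_form X Y Z p = 0].

(* nabla is meant to be the Levi-Civita connection of g. *)
Definition weakly_para_cosymplectic : Prop :=
  almost_para_cosymplectic /\
  forall p X Y Z, vsmooth_at X p -> vsmooth_at Y p -> vsmooth_at Z p ->
    curvature nabla X Y (fun q => phi q (Z q)) p = phi p (curvature nabla X Y Z p).

(* On every leaf i : N -> M, the structure (P, H) is the one induced by (phi, g)
   through the differential of i. *)
Definition para_kahler_leaves : Prop :=
  forall (N : smoothManifold R k) (i : N -> M), leaf eta i ->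
  forall (P : endofield N) (H : bilinfield N) (nablaN : connection (M := N)),
    (forall q (v : tangent q), tmap i (P q v) = phi (i q) (tmap i v)) ->
    (forall q (v w : tangent q), H q v w = g (i q) (tmap i v) (tmap i w)) ->
    levi_civita H nablaN -> parallel_endo nablaN P.

Definition shape_op : vfield M -> vfield M := fun X p => - nabla X xi p.

(* A X = eps (g(X, V1) V1 + sigma g(X, V2) V2) on the open set W; the sign eps
   is normalised to 1, replacing (xi, eta) with (- xi, - eta) if necessary. *)
Definition shape_normal_form (sigma : R) (W : set M) (V1 V2 : vfield M) : Prop :=
  forall p : M, W p ->
  [/\ [/\ vsmooth_at V1 p, vsmooth_at V2 p, V1 p <> 0 & V2 p <> 0],
      [/\ phi p (V1 p) = - V1 p, phi p (V2 p) = V2 p & g p (V1 p) (V2 p) = 0] &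
      forall X, vsmooth_at X p ->
        shape_op X p = g p (X p) (V1 p) *: V1 p + (sigma * g p (X p) (V2 p)) *: V2 p].

Definition shape_type (sigma : R) : Prop :=
  forall p : M, exists (W : set M) (V1 V2 : vfield M),
    [/\ open W, W p & shape_normal_form sigma W V1 V2].

Definition elliptic : Prop := shape_type 1.
Definition hyperbolic : Prop := shape_type (-1).

End ParaContact.

Section AdoptedFrame.
Context {R : realType} {n : nat} {M : smoothManifold R n}.

Definition local_frame (U : set M) (V : 'I_n -> vfield M) : Prop :=
  forall p, U p -> (forall i, vsmooth_at (V i) p) /\
    forall v : tangent p,
      exists! c : {ffun 'I_n -> R}, v = \sum_(i < n) c i *: V i p.

Definition dual_form (g : bilinfield M) (X : vfield M) : oneform M :=
  fun p => g p (X p).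

End AdoptedFrame.

Section Dim5.
Context {R : realType} {M : smoothManifold R 5}.
Local Unset Implicit Arguments.
Variables (phi : endofield M) (xi : vfield M) (eta : oneform M) (g : bilinfield M).
Variable nabla : connection (M := M).
Local Set Implicit Arguments.

Definition adopted_pairs : seq ('I_5 * 'I_5) :=
  [:: (0, 0); (1, 3); (3, 1); (2, 4); (4, 2)].

Definition adopted_frame (sigma : R) (U : set M) (V : 'I_5 -> vfield M) : Prop :=
  [/\ local_frame U V, forall p, U p -> V 0 p = xi p,
      shape_normal_form phi xi g nabla sigma U (V 1) (V 2),
      forall p, U p -> phi p (V 3 p) = V 3 p /\ phi p (V 4 p) = - V 4 p &
      forall p i j, U p -> g p (V i p) (V j p) = ((i, j) \in adopted_pairs)%:R].

Definition associated_forms (U : set M) (V : 'I_5 -> vfield M)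
    (tau1 tau2 omega : oneform M) : Prop :=
  [/\ oneform_smooth_on U tau1, oneform_smooth_on U tau2,
      oneform_smooth_on U omega &
      forall p X, U p -> vsmooth_at X p ->
        [/\ nabla X (V 1) p = tau1 p (X p) *: V 1 p,
            nabla X (V 2) p = tau2 p (X p) *: V 2 p &
            omega p (X p) = g p (nabla X (V 3) p) (V 4 p)]].

Definition Theta (V : 'I_5 -> vfield M) (i j : 'I_5) : twoform :=
  fun X Y p => 2 * wedge11 (dual_form g (V i)) (dual_form g (V j)) X Y p.

Definition Domega (tau1 tau2 omega : oneform M) : twoform :=
  fun X Y p => d1 omega X Y p - wedge11 omega (add_oneform tau1 tau2) X Y p.

Definition curvature4 (X Y Z W : vfield M) (p : M) : R :=
  g p (curvature nabla X Y Z p) (W p).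

End Dim5.

(* Main.v *)
(* Metric compatibility turns nabla V1 = tau1 V1, nabla V2 = tau2 V2 and the
   formula for A into the full connection matrix of the adopted frame, and
   R(X, Y) V_i is obtained by differentiating it once more.  Since R(X, Y)
   commutes with phi and phi xi = 0, R(X, Y) xi is a multiple of xi; but it is
   also a combination of V1 and V2, so it vanishes, and this says precisely that
   tau1 and tau2 are multiples of theta1 and theta2.  Tensoriality of R in Z then
   gives the curvature formula.  In the first Bianchi identity the terms in A
   cancel because A is self-adjoint, and inserting W = V1, ..., V4 in what is left
   yields the four identities between the forms. *)
Require Import Defs.
From mathcomp Require Import all_boot all_order all_algebra.
From mathcomp Require Import all_classical all_reals all_analysis.
From mathcomp Require Import ring.
Set Implicit Arguments.
Unset Strict Implicit.
Unset Printing Implicit Defensive.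
Import Order.TTheory GRing.Theory Num.Theory.
Import numFieldNormedType.Exports.
Local Open Scope classical_set_scope.
Local Open Scope ring_scope.

(** * Smooth functions *)

Section SmoothFunctionTheory.
Context {R : realType} {n : nat}.
Implicit Types (A : set 'rV[R]_n) (f h : 'rV[R]_n -> R).

Lemma CnW k A f : Cn k.+1 A f -> Cn k A f.
Proof.
elim: k f => [|k IH] f [fc fd]; split=> // i.
by have [? /IH] := fd i.
Qed.

Lemma Cn_subset k A B f : B `<=` A -> Cn k A f -> Cn k B f.
Proof.
move=> BA; elim: k f => [|k IH] f [fc fd]; split=> //; try by move=> x /BA/fc.
move=> i; have [fdi /IH Df] := fd i; split=> // x /BA/fdi//.
Qed.

Lemma Cn_eq k A f h : open A -> (forall x, A x -> f x = h x) ->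
  Cn k A f -> Cn k A h.
Proof.
move=> oA; elim: k f h => [|k IH] f h fh [fc fd];
  have fhn x : A x -> \near x, f x = h x by
    (move=> Ax; have : nbhs x A by [apply: open_nbhs_nbhs];
     apply: filterS => y /fh).
all: have hc x : A x -> {for x, continuous h} by
  (move=> Ax; rewrite /prop_for /continuous_at -fh//;
   apply: cvg_trans (fc _ Ax); exact: (near_eq_cvg (F := nbhs x) (fhn _ Ax))).
all: split=> // i.
have [fdi Df] := fd i; split=> [x Ax|].
  by apply: near_eq_derivable (fhn _ Ax) _; exact: fdi.
by apply: IH Df => x Ax; apply: near_eq_derive; exact: fhn.
Qed.

Lemma Cn_cst k A (c : R) : Cn k A (cst c).
Proof.
elim: k c => [|k IH] c; split=> //; try by move=> x _; exact: cst_continuous.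
move=> i; split=> [x _|]; first exact: derivable_cst.
rewrite (_ : (fun x => _) = cst 0) //; apply/funext => x.
exact: derive_cst.
Qed.

Lemma CnD k A f h : open A -> Cn k A f -> Cn k A h ->
  Cn k A (fun x => f x + h x).
Proof.
move=> oA; elim: k f h => [|k IH] f h [fc fd] [hc hd]; split=> //;
  try by move=> x Ax; apply: continuousD; [exact: fc|exact: hc].
move=> i; have [fdi Df] := fd i; have [hdi Dh] := hd i.
split=> [x Ax|]; first by apply: derivableD; [exact: fdi|exact: hdi].
apply: Cn_eq (IH _ _ Df Dh) => // x Ax.
by rewrite -deriveD//; [exact: fdi|exact: hdi].
Qed.

Lemma CnM k A f h : open A -> Cn k A f -> Cn k A h ->
  Cn k A (fun x => f x * h x).
Proof.
move=> oA; elim: k f h => [|k IH] f h fS hS; have [fc fd] := fS;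
  have [hc hd] := hS; split=> //;
  try by move=> x Ax; apply: continuousM; [exact: fc|exact: hc].
move=> i; have [fdi Df] := fd i; have [hdi Dh] := hd i.
split=> [x Ax|]; first by apply: derivableM; [exact: fdi|exact: hdi].
have := CnD oA (IH _ _ (CnW fS) Dh) (IH _ _ (CnW hS) Df).
by apply: Cn_eq => // x Ax; rewrite deriveM//; [exact: fdi|exact: hdi].
Qed.

End SmoothFunctionTheory.

Section SmoothAt.
Context {R : realType} {n : nat} {M : smoothManifold R n}.
Implicit Types (p : M) (f h : M -> R).

Lemma open_chart_image (c : chart R n M) (W : set M) :
  open W -> open (cmap c @` (W `&` cdom c)).
Proof.
move=> oW; rewrite openE => x [p [Wp cp] <-].
have Ix : (cmap c @` cdom c) (cmap c p) by exists p.
have : nbhs (cmap c p) (cmap c @` cdom c).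
  by apply: open_nbhs_nbhs; split=> //; exact: cimg_open.
have : nbhs (cmap c p) (cinv c @^-1` W).
  have := cinv_continuous Ix; rewrite /prop_for /continuous_at cmapK// => /(_ W).
  by apply; apply: open_nbhs_nbhs.
apply: filterS2 => y Wy [q cq qy]; exists q => //; split=> //.
by move: Wy; rewrite /= -qy cmapK.
Qed.

Lemma smooth_at_near p f : smooth_at f p -> \forall q \near p, smooth_at f q.
Proof.
move=> [W [oW Wp] fW]; have : nbhs p W by apply: open_nbhs_nbhs.
by apply: filterS => q Wq; exists W.
Qed.

Lemma smooth_at_eq p f h : (\forall q \near p, f q = h q) ->
  smooth_at f p -> smooth_at h p.
Proof.
move=> fh [W [oW Wp] fW].
exists (W `&` [set q | f q = h q]°).
  by split; [apply: openI => //; exact: open_interior|split].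
move=> c ac k; apply: (@Cn_eq _ _ _ _ (f \o cinv c)).
- by apply: open_chart_image; apply: openI => //; exact: open_interior.
- by move=> x [q [[_ /interior_subset fhq] cq] <-]; rewrite /= cmapK.
- by apply: Cn_subset (fW _ ac k) => x [q [[Wq _] cq] <-]; exists q.
Qed.

Lemma smooth_at_cst p (c : R) : smooth_at (fun=> c) p.
Proof.
exists setT; first by split=> //; exact: openT.
by move=> ch _ k; exact: Cn_cst.
Qed.

Lemma smooth_at_op2 (op : R -> R -> R) :
  (forall k (A : set 'rV[R]_n) (f h : 'rV[R]_n -> R), open A ->
     Cn k A f -> Cn k A h ->
     Cn k A (fun x => op (f x) (h x))) ->
  forall p f h, smooth_at f p -> smooth_at h p ->
    smooth_at (fun q => op (f q) (h q)) p.
Proof.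
move=> opC p f h [W [oW Wp] fW] [W' [oW' Wp'] hW].
exists (W `&` W'); first by split; [exact: openI|].
move=> c ac k; apply: (opC k _ (f \o cinv c) (h \o cinv c)).
- by apply: open_chart_image; exact: openI.
- by apply: Cn_subset (fW _ ac k) => x [q [[Wq _] cq] <-]; exists q.
- by apply: Cn_subset (hW _ ac k) => x [q [[_ Wq] cq] <-]; exists q.
Qed.

Lemma smooth_atD p f h : smooth_at f p -> smooth_at h p ->
  smooth_at (fun q => f q + h q) p.
Proof. by apply: (@smooth_at_op2 +%R) => *; exact: CnD. Qed.

Lemma smooth_atM p f h : smooth_at f p -> smooth_at h p ->
  smooth_at (fun q => f q * h q) p.
Proof. by apply: (@smooth_at_op2 *%R) => *; exact: CnM. Qed.

Lemma smooth_atZ p (a : R) f : smooth_at f p -> smooth_at (fun q => a * f q) p.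
Proof. by move=> fS; apply: smooth_atM => //; exact: smooth_at_cst. Qed.

Lemma smooth_atN p f : smooth_at f p -> smooth_at (fun q => - f q) p.
Proof.
move=> /(smooth_atZ (-1)); apply: smooth_at_eq.
by apply: nearW => q; rewrite mulN1r.
Qed.

Lemma smooth_atB p f h : smooth_at f p -> smooth_at h p ->
  smooth_at (fun q => f q - h q) p.
Proof. by move=> fS hS; apply: smooth_atD => //; exact: smooth_atN. Qed.

End SmoothAt.

(** * Tangent vectors and vector fields *)

Section TangentTheory.
Context {R : realType} {n : nat} {M : smoothManifold R n}.
Implicit Types (p : M) (f h : M -> R).

Lemma tangentP p (v : tangent p) : derivation_at p v.
Proof. by case: v => v /= /asboolP. Qed.

Lemma tangent0E p f : (0 : tangent p) f = 0.
Proof. by have -> : tangent_val (0 : tangent p) = 0 by exact: (raddf0 val). Qed.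

Lemma tangentDE p (v w : tangent p) f : (v + w) f = v f + w f.
Proof.
by have -> : tangent_val (v + w) = tangent_val v + tangent_val w
  by exact: (raddfD val).
Qed.

Lemma tangentNE p (v : tangent p) f : (- v) f = - v f.
Proof.
by have -> : tangent_val (- v) = - tangent_val v by exact: (raddfN val).
Qed.

Lemma tangentZE p (a : R) (v : tangent p) f : (a *: v) f = a * v f.
Proof.
by have -> : tangent_val (a *: v) = a *: tangent_val v by exact: (linearZZ val).
Qed.

Definition tangentE := (tangentDE, tangentNE, tangentZE, tangent0E).

Lemma tangent_ext p (v w : tangent p) :
  (forall f, smooth_at f p -> v f = w f) -> v = w.
Proof.
move=> vw; apply: val_inj; apply/funext => f.
have [/vw//|nf] := pselect (smooth_at f p).
have [v0 _ _ _] := tangentP v; have [w0 _ _ _] := tangentP w.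
exact: etrans (v0 _ nf) (esym (w0 _ nf)).
Qed.

Lemma tangent_near p (v : tangent p) f h :
  (\forall q \near p, f q = h q) -> smooth_at f p -> v f = v h.
Proof.
move=> fh fS; have [_ E _ _] := tangentP v; apply: E => //.
exact: smooth_at_eq fS.
Qed.

Lemma tangent_lin p (v : tangent p) (a : R) f h : smooth_at f p ->
  smooth_at h p -> v (fun q => a * f q + h q) = a * v f + v h.
Proof. by have [_ _ L _] := tangentP v; exact: L. Qed.

Lemma tangentM p (v : tangent p) f h : smooth_at f p -> smooth_at h p ->
  v (fun q => f q * h q) = v f * h p + f p * v h.
Proof. by have [_ _ _ L] := tangentP v; exact: L. Qed.

Lemma tangentD p (v : tangent p) f h : smooth_at f p -> smooth_at h p ->
  v (fun q => f q + h q) = v f + v h.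
Proof.
move=> fS hS; rewrite -[v f]mul1r -tangent_lin//.
by congr (tangent_val v); apply/funext => q; rewrite mul1r.
Qed.

Lemma tangent_cst p (v : tangent p) (c : R) : v (fun=> c) = 0.
Proof.
have S (a : R) : smooth_at (fun=> a) p by exact: smooth_at_cst.
have v1 : v (fun=> 1) = 0.
  have := tangentM v (S 1) (S 1); rewrite !mulr1 mul1r => e.
  by apply: (addrI (v (fun=> 1))); rewrite addr0 -e.
have v0 : v (fun=> 0) = 0.
  have := tangentD v (S 0) (S 0); rewrite addr0 => e.
  by apply: (addrI (v (fun=> 0))); rewrite addr0 -e.
have := tangent_lin v c (S 1) (S 0); by rewrite v1 v0 !mulr0 !mulr1 !addr0.
Qed.

Lemma tangentN p (v : tangent p) f : smooth_at f p ->
  v (fun q => - f q) = - v f.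
Proof.
move=> fS; rewrite -[RHS]addr0 -mulN1r -(tangent_cst v 0).
rewrite -tangent_lin//; last exact: smooth_at_cst.
by congr (tangent_val v); apply/funext => q; rewrite mulN1r addr0.
Qed.

Lemma tangentB p (v : tangent p) f h : smooth_at f p -> smooth_at h p ->
  v (fun q => f q - h q) = v f - v h.
Proof.
by move=> fS hS; rewrite tangentD// ?tangentN//; exact: smooth_atN.
Qed.

Lemma to_tangentE p (D : (M -> R) -> R) :
  (forall f h, smooth_at f p -> smooth_at h p ->
    (\forall q \near p, f q = h q) -> D f = D h) ->
  (forall (a : R) f h, smooth_at f p -> smooth_at h p ->
    D (fun q => a * f q + h q) = a * D f + D h) ->
  (forall f h, smooth_at f p -> smooth_at h p ->
    D (fun q => f q * h q) = D f * h p + f p * D h) ->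
  forall f, smooth_at f p -> to_tangent p D f = D f.
Proof.
move=> DE DL DM f fS; rewrite /to_tangent /insubd insubT /=; last first.
  by move=> _; case: asboolP.
apply/asboolP; split.
- by move=> h nh; case: asboolP.
- by move=> h k hS kS hk; rewrite !asboolT//; exact: DE.
- move=> a h k hS kS; rewrite !asboolT//; first exact: DL.
  by apply: smooth_atD => //; exact: smooth_atZ.
- by move=> h k hS kS; rewrite !asboolT//; [exact: DM|exact: smooth_atM].
Qed.

End TangentTheory.

Section VectorFields.
Context {R : realType} {n : nat} {M : smoothManifold R n}.
Implicit Types (p : M) (f h : M -> R) (X Y Z : vfield M).

Lemma vsmooth_near X p : vsmooth_at X p -> \forall q \near p, vsmooth_at X q.
Proof. exact: near_join. Qed.

Lemma vsmoothE X p f : vsmooth_at X p -> smooth_at f p ->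
  smooth_at (fun q => X q f) p.
Proof. by move=> /nbhs_singleton; apply. Qed.

Lemma vsmooth_eq X Y p : (\forall q \near p, X q = Y q) ->
  vsmooth_at X p -> vsmooth_at Y p.
Proof.
move=> /near_join XY XS; apply: filterS2 XY XS => q XY XS f fS.
by apply: smooth_at_eq (XS _ fS); apply: filterS XY => r ->.
Qed.

Lemma vsmooth_lin f X Y p : smooth_at f p -> vsmooth_at X p ->
  vsmooth_at Y p -> vsmooth_at (fun q => f q *: X q + Y q) p.
Proof.
move=> /smooth_at_near fS XS YS; apply: filterS3 fS XS YS => q fS XS YS h hS.
rewrite (_ : (fun r => _) = fun r => f r * X r h + Y r h); last first.
  by apply/funext => r; rewrite !tangentE.
by apply: smooth_atD; [apply: smooth_atM => //; exact: XS|exact: YS].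
Qed.

Lemma vsmooth0 p : vsmooth_at (fun=> 0 : tangent _) p.
Proof.
apply: nearW => q f fS; rewrite (_ : (fun r => _) = fun=> 0).
  exact: smooth_at_cst.
by apply/funext => r; rewrite tangentE.
Qed.

Lemma vsmoothZ f X p : smooth_at f p -> vsmooth_at X p ->
  vsmooth_at (fun q => f q *: X q) p.
Proof.
move=> fS XS; apply: vsmooth_eq (vsmooth_lin fS XS (vsmooth0 p)).
by apply: nearW => q; rewrite addr0.
Qed.

Lemma vsmoothB X Y p : vsmooth_at X p -> vsmooth_at Y p ->
  vsmooth_at (fun q => X q - Y q) p.
Proof.
move=> XS YS; apply: vsmooth_eq (vsmooth_lin (smooth_at_cst p (-1)) YS XS).
by apply: nearW => q; rewrite scaleN1r addrC.
Qed.

Lemma lieE X Y p : vsmooth_at X p -> vsmooth_at Y p ->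
  forall f, smooth_at f p ->
  lie X Y p f = X p (fun q => Y q f) - Y p (fun q => X q f).
Proof.
move=> XS YS.
have E A B f h : vsmooth_at A p -> vsmooth_at B p -> smooth_at f p ->
    (\forall q \near p, f q = h q) ->
    A p (fun q => B q f) = A p (fun q => B q h).
  move=> AS BS fS fh; apply: tangent_near; last exact: vsmoothE.
  apply: filterS2 (near_join fh) (smooth_at_near fS) => q ? ?.
  exact: tangent_near.
have L A B a f h : vsmooth_at A p -> vsmooth_at B p ->
    smooth_at f p -> smooth_at h p ->
    A p (fun q => B q (fun r => a * f r + h r)) =
    a * A p (fun q => B q f) + A p (fun q => B q h).
  move=> AS BS fS hS; rewrite -tangent_lin; try exact: vsmoothE.
  apply: tangent_near; last first.
    by apply: vsmoothE => //; apply: smooth_atD => //; exact: smooth_atZ.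
  apply: filterS2 (smooth_at_near fS) (smooth_at_near hS) => q ? ?.
  exact: tangent_lin.
have P A B f h : vsmooth_at A p -> vsmooth_at B p ->
    smooth_at f p -> smooth_at h p ->
    A p (fun q => B q (fun r => f r * h r)) =
    A p (fun q => B q f) * h p + B p f * A p h
    + (A p f * B p h + f p * A p (fun q => B q h)).
  move=> AS BS fS hS.
  have fB := vsmoothE BS fS; have hB := vsmoothE BS hS.
  rewrite -!tangentM// -tangentD//; try exact: smooth_atM.
  apply: tangent_near; last by apply: vsmoothE => //; exact: smooth_atM.
  apply: filterS2 (smooth_at_near fS) (smooth_at_near hS) => q ? ?.
  exact: tangentM.
apply: to_tangentE.
- by move=> f h fS hS fh; congr (_ - _); exact: E.
- by move=> a f h fS hS; rewrite !L//; ring.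
- by move=> f h fS hS; rewrite !P//; ring.
Qed.

End VectorFields.

Section LieAlgebra.
Context {R : realType} {n : nat} {M : smoothManifold R n}.
Implicit Types (p : M) (f h : M -> R) (X Y Z : vfield M).

Lemma vsmooth_lie X Y p : vsmooth_at X p -> vsmooth_at Y p ->
  vsmooth_at (lie X Y) p.
Proof.
move=> /vsmooth_near XS /vsmooth_near YS; apply: filterS2 XS YS => q XS YS f fS.
apply: (@smooth_at_eq _ _ _ _
  (fun r => X r (fun q => Y q f) - Y r (fun q => X q f))).
  apply: filterS3 (vsmooth_near XS) (vsmooth_near YS) (smooth_at_near fS).
  by move=> r ? ? ?; rewrite lieE.
by apply: smooth_atB; apply: vsmoothE => //; exact: vsmoothE.
Qed.

Lemma lie_jacobi X Y Z p : vsmooth_at X p -> vsmooth_at Y p ->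
  vsmooth_at Z p ->
  lie X (lie Y Z) p + lie Y (lie Z X) p + lie Z (lie X Y) p = 0.
Proof.
move=> XS YS ZS; apply: tangent_ext => f fS.
have L A B C : vsmooth_at A p -> vsmooth_at B p -> vsmooth_at C p ->
    lie A (lie B C) p f = A p (fun q => B q (fun r => C r f))
      - A p (fun q => C q (fun r => B r f))
      - (B p (fun q => C q (fun r => A r f))
         - C p (fun q => B q (fun r => A r f))).
  move=> AS BS CS; rewrite lieE//; last exact: vsmooth_lie.
  rewrite lieE//; last exact: vsmoothE.
  rewrite -[in RHS]tangentB; try by apply: vsmoothE => //; exact: vsmoothE.
  congr (_ - _); apply: tangent_near; last first.
    by apply: vsmoothE => //; exact: vsmooth_lie.
  apply: filterS3 (vsmooth_near BS) (vsmooth_near CS) (smooth_at_near fS).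
  by move=> q ? ? ?; rewrite lieE.
by rewrite !tangentE !L//; ring.
Qed.

End LieAlgebra.

(** * The Levi-Civita connection and its curvature *)

Section ConnectionTheory.
Context {R : realType} {n : nat} {M : smoothManifold R n}.
Local Unset Implicit Arguments.
Context (g : bilinfield M) (nabla : connection (M := M)).
Local Set Implicit Arguments.
Hypothesis LC : levi_civita g nabla.
Implicit Types (p : M) (f : M -> R) (X Y Z : vfield M) (a : oneform M).
Implicit Types (T : vfield M -> vfield M).

Lemma nabla_smooth p X Y : vsmooth_at X p -> vsmooth_at Y p ->
  vsmooth_at (nabla X Y) p.
Proof. by case: LC => -[H _ _ _] _ _; exact: H. Qed.

Lemma nabla_near p X Y Y' : vsmooth_at X p -> vsmooth_at Y p ->
  (\forall q \near p, Y q = Y' q) -> nabla X Y p = nabla X Y' p.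
Proof. by case: LC => -[_ H _ _] _ _ XS YS; apply: H => //; exact: nearW. Qed.

Lemma nabla_lin p f X Y Y' : smooth_at f p ->
  vsmooth_at X p -> vsmooth_at Y p -> vsmooth_at Y' p ->
  nabla X (fun q => f q *: Y q + Y' q) p =
    X p f *: Y p + f p *: nabla X Y p + nabla X Y' p.
Proof. by case: LC => -[_ _ _ H] _ _; exact: H. Qed.

Lemma nabla0 p X : vsmooth_at X p -> nabla X (fun=> 0) p = 0.
Proof.
move=> XS; have Z := vsmooth0 p.
have := nabla_lin (smooth_at_cst p 1) XS Z Z.
rewrite tangent_cst scale0r add0r scale1r => e.
apply: (addrI (nabla X (fun=> 0) p)); rewrite addr0 -e.
congr (nabla X _ p); apply/functional_extensionality_dep => q.
by rewrite scaler0 addr0.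
Qed.

Lemma nablaZ p f X Y : smooth_at f p -> vsmooth_at X p -> vsmooth_at Y p ->
  nabla X (fun q => f q *: Y q) p = X p f *: Y p + f p *: nabla X Y p.
Proof.
move=> fS XS YS; rewrite -[RHS]addr0 -(nabla0 XS) -nabla_lin//; last exact: vsmooth0.
by apply: nabla_near; [|exact: vsmoothZ|apply: nearW => q; rewrite addr0].
Qed.

Lemma nabla_comb p (c : R) X Y Y' : vsmooth_at X p -> vsmooth_at Y p ->
  vsmooth_at Y' p ->
  nabla X (fun q => c *: Y q + Y' q) p = c *: nabla X Y p + nabla X Y' p.
Proof.
move=> XS YS YS'; rewrite nabla_lin//; last exact: smooth_at_cst.
by rewrite tangent_cst scale0r add0r.
Qed.

Lemma nablaB p X Y Y' : vsmooth_at X p -> vsmooth_at Y p -> vsmooth_at Y' p ->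
  nabla X (fun q => Y q - Y' q) p = nabla X Y p - nabla X Y' p.
Proof.
move=> XS YS YS'; rewrite addrC -scaleN1r -nabla_comb//.
apply: nabla_near; [by []|exact: vsmoothB|].
by apply: nearW => q; rewrite scaleN1r addrC.
Qed.

Lemma torsion_free p X Y : vsmooth_at X p -> vsmooth_at Y p ->
  nabla X Y p - nabla Y X p = lie X Y p.
Proof. by case: LC => _ H _; exact: H. Qed.

Lemma nabla_metric p X Y Z : vsmooth_at X p -> vsmooth_at Y p ->
  vsmooth_at Z p ->
  X p (fun q => g q (Y q) (Z q)) =
    g p (nabla X Y p) (Z p) + g p (Y p) (nabla X Z p).
Proof. by case: LC => _ _ H; exact: H. Qed.

Lemma bianchi1 p X Y Z : vsmooth_at X p -> vsmooth_at Y p -> vsmooth_at Z p ->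
  curvature nabla X Y Z p + curvature nabla Y Z X p + curvature nabla Z X Y p
  = 0.
Proof.
move=> XS YS ZS; rewrite -(lie_jacobi XS YS ZS).
have B A B C : vsmooth_at A p -> vsmooth_at B p -> vsmooth_at C p ->
    lie A (lie B C) p =
    nabla A (nabla B C) p - nabla A (nabla C B) p - nabla (lie B C) A p.
  move=> AS BS CS; rewrite -torsion_free//; last exact: vsmooth_lie.
  congr (_ - _); rewrite -nablaB//; try exact: nabla_smooth.
  apply: nabla_near => //; first exact: vsmooth_lie.
  apply: filterS2 (vsmooth_near BS) (vsmooth_near CS) => q ? ?.
  by rewrite torsion_free.
rewrite !B// /curvature; apply: tangent_ext => f _; rewrite !tangentE; ring.
Qed.

(* The exterior covariant derivative of a vector-valued 1-form T; the curvature
   R(X, Y) Z is the case T = nabla Z. *)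
Definition dnabla T X Y : vfield M := fun p =>
  nabla X (T Y) p - nabla Y (T X) p - T (lie X Y) p.

Lemma dnabla_near p T T' X Y : vsmooth_at X p -> vsmooth_at Y p ->
  (forall Z, vsmooth_at Z p -> vsmooth_at (T Z) p) ->
  (forall Z, vsmooth_at Z p -> \forall q \near p, T Z q = T' Z q) ->
  dnabla T X Y p = dnabla T' X Y p.
Proof.
move=> XS YS TS TT; have LS := vsmooth_lie XS YS.
rewrite /dnabla (nbhs_singleton (TT _ LS)).
by congr (_ - _ - _); apply: nabla_near; auto.
Qed.

Lemma dnabla_comb p (c : R) T T' X Y : vsmooth_at X p -> vsmooth_at Y p ->
  (forall Z, vsmooth_at Z p -> vsmooth_at (T Z) p) ->
  (forall Z, vsmooth_at Z p -> vsmooth_at (T' Z) p) ->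
  dnabla (fun Z q => c *: T Z q + T' Z q) X Y p =
    c *: dnabla T X Y p + dnabla T' X Y p.
Proof.
move=> XS YS TS TS'; rewrite /dnabla !nabla_comb; auto.
by apply: tangent_ext => f _; rewrite !tangentE; ring.
Qed.

Lemma dnablaZ p (c : R) T X Y : vsmooth_at X p -> vsmooth_at Y p ->
  (forall Z, vsmooth_at Z p -> vsmooth_at (T Z) p) ->
  dnabla (fun Z q => c *: T Z q) X Y p = c *: dnabla T X Y p.
Proof.
move=> XS YS TS; have cS := smooth_at_cst p c.
rewrite /dnabla !nablaZ ?tangent_cst; auto.
by apply: tangent_ext => f _; rewrite !tangentE; ring.
Qed.

Lemma dnabla_tensor p a Z X Y : vsmooth_at X p -> vsmooth_at Y p ->
  vsmooth_at Z p ->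
  (forall W, vsmooth_at W p -> smooth_at (fun q => a q (W q)) p) ->
  dnabla (fun W q => a q (W q) *: Z q) X Y p =
    (2 * d1 a X Y p) *: Z p + a p (Y p) *: nabla X Z p
    - a p (X p) *: nabla Y Z p.
Proof.
move=> XS YS ZS aS; rewrite /dnabla !nablaZ; auto.
rewrite /d1 mulrA divff ?pnatr_eq0// mul1r.
by apply: tangent_ext => f _; rewrite !tangentE; ring.
Qed.

Lemma curvature_near p X Y Z Z' : vsmooth_at X p -> vsmooth_at Y p ->
  vsmooth_at Z p -> (\forall q \near p, Z q = Z' q) ->
  curvature nabla X Y Z p = curvature nabla X Y Z' p.
Proof.
move=> XS YS ZS ZZ.
apply: (@dnabla_near p (nabla^~ Z) (nabla^~ Z')) => // W WS.
  exact: nabla_smooth.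
apply: filterS3 (vsmooth_near WS) (vsmooth_near ZS) (near_join ZZ) => q ? ? ?.
exact: nabla_near.
Qed.

Lemma curvature_lin p f X Y Z Z' : smooth_at f p -> vsmooth_at X p ->
  vsmooth_at Y p -> vsmooth_at Z p -> vsmooth_at Z' p ->
  curvature nabla X Y (fun q => f q *: Z q + Z' q) p =
    f p *: curvature nabla X Y Z p + curvature nabla X Y Z' p.
Proof.
move=> fS XS YS ZS ZS'.
have D A B : vsmooth_at A p -> vsmooth_at B p ->
    nabla A (nabla B (fun q => f q *: Z q + Z' q)) p =
    A p (fun q => B q f) *: Z p + B p f *: nabla A Z p
    + (A p f *: nabla B Z p + f p *: nabla A (nabla B Z) p
       + nabla A (nabla B Z') p).
  move=> AS BS; have BfS := vsmoothE BS fS.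
  rewrite -!nabla_lin//; try exact: nabla_smooth.
    apply: nabla_near => //; first by apply: nabla_smooth => //; exact: vsmooth_lin.
    apply: filterS3 (filterI (vsmooth_near ZS) (vsmooth_near ZS'))
      (vsmooth_near BS) (smooth_at_near fS) => q [? ?] ? ?.
    by rewrite nabla_lin// addrA.
  by apply: vsmooth_lin => //; exact: nabla_smooth.
have LS := vsmooth_lie XS YS.
rewrite /curvature !D// nabla_lin// lieE//.
by apply: tangent_ext => h _; rewrite !tangentE; ring.
Qed.

Lemma curvature0 p X Y : vsmooth_at X p -> vsmooth_at Y p ->
  curvature nabla X Y (fun=> 0) p = 0.
Proof.
move=> XS YS; have Z := vsmooth0 p.
have := curvature_lin (smooth_at_cst p 1) XS YS Z Z; rewrite scale1r.
rewrite -(@curvature_near _ _ _ (fun=> 0))//.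
  move=> e; apply: (addrI (curvature nabla X Y (fun=> 0) p)).
  by rewrite addr0 -e.
by apply: nearW => q; rewrite scaler0 addr0.
Qed.

Lemma curvatureZ p f X Y Z : smooth_at f p -> vsmooth_at X p ->
  vsmooth_at Y p -> vsmooth_at Z p ->
  curvature nabla X Y (fun q => f q *: Z q) p = f p *: curvature nabla X Y Z p.
Proof.
move=> fS XS YS ZS; rewrite -[RHS]addr0 -(curvature0 XS YS).
rewrite -curvature_lin//; last exact: vsmooth0.
apply: curvature_near => //; first exact: vsmoothZ.
by apply: nearW => q; rewrite addr0.
Qed.

End ConnectionTheory.

Section MetricTheory.
Context {R : realType} {n : nat} {M : smoothManifold R n}.
Local Unset Implicit Arguments.
Context (g : bilinfield M) (nabla : connection (M := M)).
Local Set Implicit Arguments.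
Hypothesis LC : levi_civita g nabla.
Hypothesis PR : pseudo_riemannian g.
Implicit Types (p : M) (X Y Z : vfield M).

Lemma metricC p (v w : tangent p) : g p v w = g p w v.
Proof. by case: PR. Qed.

Lemma metric_smooth p X Y : vsmooth_at X p -> vsmooth_at Y p ->
  smooth_at (fun q => g q (X q) (Y q)) p.
Proof. by case: PR => H _ _; exact: H. Qed.

Lemma metricDr p (u v w : tangent p) : g p u (v + w) = g p u v + g p u w.
Proof. exact: raddfD. Qed.

Lemma metricNr p (u v : tangent p) : g p u (- v) = - g p u v.
Proof. exact: raddfN. Qed.

Lemma metricZr p (a : R) (u v : tangent p) : g p u (a *: v) = a * g p u v.
Proof. exact: linearZ. Qed.

Lemma metricDl p (u v w : tangent p) : g p (v + w) u = g p v u + g p w u.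
Proof. by rewrite !(metricC _ u) metricDr. Qed.

Lemma metricNl p (u v : tangent p) : g p (- v) u = - g p v u.
Proof. by rewrite !(metricC _ u) metricNr. Qed.

Lemma metricZl p (a : R) (u v : tangent p) : g p (a *: v) u = a * g p v u.
Proof. by rewrite !(metricC _ u) metricZr. Qed.

Lemma metric0r p (u : tangent p) : g p u 0 = 0.
Proof. exact: raddf0. Qed.

Definition metricE :=
  (metricDr, metricNr, metricZr, metricDl, metricNl, metricZl).

Lemma dual_form_smooth p X Y : vsmooth_at X p -> vsmooth_at Y p ->
  smooth_at (fun q => dual_form g X q (Y q)) p.
Proof. exact: metric_smooth. Qed.

Lemma d1_dual_form p Z X Y : vsmooth_at X p -> vsmooth_at Y p ->
  vsmooth_at Z p ->
  2 * d1 (dual_form g Z) X Y p =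
    g p (nabla X Z p) (Y p) - g p (nabla Y Z p) (X p).
Proof.
move=> XS YS ZS; rewrite /d1 mulrA divff ?pnatr_eq0// mul1r /dual_form.
rewrite !(nabla_metric LC)// -(torsion_free LC XS YS) !metricE; ring.
Qed.

Lemma nabla_const p (c : R) X Y Z : vsmooth_at X p -> vsmooth_at Y p ->
  vsmooth_at Z p -> (\forall q \near p, g q (Y q) (Z q) = c) ->
  g p (nabla X Y p) (Z p) = - g p (Y p) (nabla X Z p).
Proof.
move=> XS YS ZS gc; apply/eqP; rewrite -addr_eq0 -(nabla_metric LC)//.
apply/eqP; rewrite -(tangent_cst (X p) c); apply: tangent_near => //.
exact: metric_smooth.
Qed.

End MetricTheory.

(** * Curvature in an adopted frame *)

Section Frame.
Context {R : realType} {M : smoothManifold R 5}.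
Local Unset Implicit Arguments.
Context (phi : endofield M) (xi : vfield M) (eta : oneform M) (g : bilinfield M).
Context (nabla : connection (M := M)) (sigma : R) (U : set M).
Context (V : 'I_5 -> vfield M) (tau1 tau2 omega : oneform M).
Local Set Implicit Arguments.
Hypothesis LC : levi_civita g nabla.
Hypothesis WPC : weakly_para_cosymplectic phi xi eta g nabla.
Hypothesis oU : open U.
Hypothesis AF : adopted_frame phi xi g nabla sigma U V.
Hypothesis TF : associated_forms g nabla U V tau1 tau2 omega.
Implicit Types (p : M) (X Y Z : vfield M).

Lemma wpc_metric : pseudo_riemannian g.
Proof. by case: WPC => -[[_ []]]. Qed.
Let PR := wpc_metric.

Lemma near_domain p : U p -> \forall q \near p, U q.
Proof. by move=> Up; apply: open_nbhs_nbhs. Qed.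

Lemma frame_smooth p i : U p -> vsmooth_at (V i) p.
Proof. by case: AF => LF _ _ _ _ /LF[]. Qed.

Lemma frame_metric p i j : U p ->
  g p (V i p) (V j p) = ((i, j) \in adopted_pairs)%:R.
Proof. by case: AF => _ _ _ _; exact. Qed.

Lemma frame_metricE p : U p ->
  ((g p (V 0 p) (V 0 p) = 1) * (g p (V 0 p) (V 1 p) = 0) *
   (g p (V 0 p) (V 2 p) = 0) * (g p (V 0 p) (V 3 p) = 0) *
   (g p (V 0 p) (V 4 p) = 0) *
   (g p (V 1 p) (V 0 p) = 0) * (g p (V 1 p) (V 1 p) = 0) *
   (g p (V 1 p) (V 2 p) = 0) * (g p (V 1 p) (V 3 p) = 1) *
   (g p (V 1 p) (V 4 p) = 0) *
   (g p (V 2 p) (V 0 p) = 0) * (g p (V 2 p) (V 1 p) = 0) *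
   (g p (V 2 p) (V 2 p) = 0) * (g p (V 2 p) (V 3 p) = 0) *
   (g p (V 2 p) (V 4 p) = 1) *
   (g p (V 3 p) (V 0 p) = 0) * (g p (V 3 p) (V 1 p) = 1) *
   (g p (V 3 p) (V 2 p) = 0) * (g p (V 3 p) (V 3 p) = 0) *
   (g p (V 3 p) (V 4 p) = 0) *
   (g p (V 4 p) (V 0 p) = 0) * (g p (V 4 p) (V 1 p) = 0) *
   (g p (V 4 p) (V 2 p) = 1) * (g p (V 4 p) (V 3 p) = 0) *
   (g p (V 4 p) (V 4 p) = 0))%type.
Proof. by move=> Up; do !split; rewrite frame_metric. Qed.

Lemma sum_I5 (W : nmodType) (F : 'I_5 -> W) :
  \sum_(i < 5) F i = F 0 + F 1 + F 2 + F 3 + F 4.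
Proof.
rewrite !big_ord_recr big_ord0 /= add0r.
by do 4?congr (_ + _); congr F; apply: val_inj.
Qed.

Lemma frame_expand p (v : tangent p) : U p ->
  v = g p (V 0 p) v *: V 0 p + g p (V 3 p) v *: V 1 p + g p (V 4 p) v *: V 2 p
      + g p (V 1 p) v *: V 3 p + g p (V 2 p) v *: V 4 p.
Proof.
move=> Up; have [LF _ _ _ _] := AF; have [_ /(_ v)[c [-> _]]] := LF _ Up.
rewrite sum_I5 !(metricE PR) !(frame_metricE Up).
by rewrite !(mulr0, mulr1, addr0, add0r).
Qed.

Lemma frame_ext p (v w : tangent p) : U p ->
  (forall i, g p v (V i p) = g p w (V i p)) -> v = w.
Proof.
move=> Up vw; rewrite (frame_expand v Up) (frame_expand w Up).
by rewrite !(metricC PR (V _ p)) !vw.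
Qed.

Lemma ord5_cases (P : 'I_5 -> Prop) :
  P 0 -> P 1 -> P 2 -> P 3 -> P 4 -> forall i, P i.
Proof.
move=> P0 P1 P2 P3 P4 [[|[|[|[|[|//]]]]] lti].
- by rewrite (_ : Ordinal lti = 0) //; apply: val_inj.
- by rewrite (_ : Ordinal lti = 1) //; apply: val_inj.
- by rewrite (_ : Ordinal lti = 2) //; apply: val_inj.
- by rewrite (_ : Ordinal lti = 3) //; apply: val_inj.
- by rewrite (_ : Ordinal lti = 4) //; apply: val_inj.
Qed.

Lemma shape_opE p X : U p -> vsmooth_at X p ->
  shape_op xi nabla X p =
  g p (X p) (V 1 p) *: V 1 p + (sigma * g p (X p) (V 2 p)) *: V 2 p.
Proof. by case: AF => _ _ NF _ _ /NF[_ _]; exact. Qed.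

Lemma nabla_V0 p X : U p -> vsmooth_at X p ->
  nabla X (V 0) p = -1 *: (dual_form g (V 1) p (X p) *: V 1 p)
    + -sigma *: (dual_form g (V 2) p (X p) *: V 2 p).
Proof.
move=> Up XS; rewrite (@nabla_near _ _ _ _ _ LC _ _ _ xi)//.
- rewrite -[LHS]opprK -[- nabla _ _ _]/(shape_op xi nabla X p) shape_opE//.
  rewrite /dual_form !(metricC PR _ (X p)).
  by rewrite scaleN1r scaleNr scalerA opprD.
- exact: frame_smooth.
- by apply: filterS (near_domain Up) => q; case: AF => _ + _ _ _; exact.
Qed.

Lemma nabla_V1 p X : U p -> vsmooth_at X p ->
  nabla X (V 1) p = tau1 p (X p) *: V 1 p.
Proof. by case: TF => _ _ _ H Up /(H _ _ Up)[]. Qed.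

Lemma nabla_V2 p X : U p -> vsmooth_at X p ->
  nabla X (V 2) p = tau2 p (X p) *: V 2 p.
Proof. by case: TF => _ _ _ H Up /(H _ _ Up)[]. Qed.

Lemma omegaE p X : U p -> vsmooth_at X p ->
  omega p (X p) = g p (nabla X (V 3) p) (V 4 p).
Proof. by case: TF => _ _ _ H Up /(H _ _ Up)[]. Qed.

Lemma frame_skew p X i j : U p -> vsmooth_at X p ->
  g p (nabla X (V i) p) (V j p) = - g p (nabla X (V j) p) (V i p).
Proof.
move=> Up XS; rewrite (metricC PR (nabla X (V j) p)).
apply: (nabla_const LC PR XS (frame_smooth i Up) (frame_smooth j Up)
  (c := ((i, j) \in adopted_pairs)%:R)).
by apply: filterS (near_domain Up) => q; exact: frame_metric.
Qed.

Lemma frame_skew0 p X i : U p -> vsmooth_at X p ->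
  g p (nabla X (V i) p) (V i p) = 0.
Proof.
move=> Up XS; have := frame_skew i i Up XS.
by move/eqP; rewrite -addr_eq0 -mulr2n mulrn_eq0 => /eqP.
Qed.

Lemma nabla_V3 p X : U p -> vsmooth_at X p ->
  nabla X (V 3) p = 1 *: (dual_form g (V 1) p (X p) *: V 0 p)
    + (1 *: (omega p (X p) *: V 2 p) + -1 *: (tau1 p (X p) *: V 3 p)).
Proof.
move=> Up XS; apply: (frame_ext Up); apply: ord5_cases.
- by rewrite frame_skew// nabla_V0// !(metricE PR) !(frame_metricE Up); ring.
- by rewrite frame_skew// nabla_V1// !(metricE PR) !(frame_metricE Up); ring.
- by rewrite frame_skew// nabla_V2// !(metricE PR) !(frame_metricE Up); ring.
- by rewrite frame_skew0// !(metricE PR) !(frame_metricE Up); ring.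
- by rewrite -omegaE// !(metricE PR) !(frame_metricE Up); ring.
Qed.

Lemma nabla_V4 p X : U p -> vsmooth_at X p ->
  nabla X (V 4) p = sigma *: (dual_form g (V 2) p (X p) *: V 0 p)
    + (-1 *: (omega p (X p) *: V 1 p) + -1 *: (tau2 p (X p) *: V 4 p)).
Proof.
move=> Up XS; apply: (frame_ext Up); apply: ord5_cases.
- by rewrite frame_skew// nabla_V0// !(metricE PR) !(frame_metricE Up); ring.
- by rewrite frame_skew// nabla_V1// !(metricE PR) !(frame_metricE Up); ring.
- by rewrite frame_skew// nabla_V2// !(metricE PR) !(frame_metricE Up); ring.
- by rewrite frame_skew// -omegaE// !(metricE PR) !(frame_metricE Up); ring.
- by rewrite frame_skew0// !(metricE PR) !(frame_metricE Up); ring.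
Qed.

Hypothesis sigma0 : sigma != 0.
Let theta i := dual_form g (V i).
Let D := Domega tau1 tau2 omega.

Lemma tau1_smooth p X : U p -> vsmooth_at X p ->
  smooth_at (fun q => tau1 q (X q)) p.
Proof. by move=> Up XS; case: TF => H _ _ _; exact: H. Qed.

Lemma tau2_smooth p X : U p -> vsmooth_at X p ->
  smooth_at (fun q => tau2 q (X q)) p.
Proof. by move=> Up XS; case: TF => _ H _ _; exact: H. Qed.

Lemma omega_smooth p X : U p -> vsmooth_at X p ->
  smooth_at (fun q => omega q (X q)) p.
Proof. by move=> Up XS; case: TF => _ _ H _; exact: H. Qed.

Lemma theta_smooth p X i : U p -> vsmooth_at X p ->
  smooth_at (fun q => theta i q (X q)) p.
Proof. by move=> Up XS; apply: dual_form_smooth => //; exact: frame_smooth. Qed.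

Lemma tensor_smooth p X i (a : oneform M) : U p ->
  smooth_at (fun q => a q (X q)) p ->
  vsmooth_at (fun q => a q (X q) *: V i q) p.
Proof. by move=> Up aX; apply: vsmoothZ => //; exact: frame_smooth. Qed.

Lemma curvature_frame p X Y i T : U p -> vsmooth_at X p -> vsmooth_at Y p ->
  (forall q Z, U q -> vsmooth_at Z q -> nabla Z (V i) q = T Z q) ->
  curvature nabla X Y (V i) p = dnabla nabla T X Y p.
Proof.
move=> Up XS YS NT; apply: (dnabla_near LC (T := nabla^~ (V i))) => // Z ZS.
  by apply: (nabla_smooth LC) => //; exact: frame_smooth.
apply: filterS2 (near_domain Up) (vsmooth_near ZS) => q ? ?; exact: NT.
Qed.

Lemma vsmooth_comb p (c : R) X Y : vsmooth_at X p -> vsmooth_at Y p ->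
  vsmooth_at (fun q => c *: X q + Y q) p.
Proof. by apply: vsmooth_lin; exact: smooth_at_cst. Qed.

Lemma curvature_V1 p X Y : U p -> vsmooth_at X p -> vsmooth_at Y p ->
  curvature nabla X Y (V 1) p = (2 * d1 tau1 X Y p) *: V 1 p.
Proof.
move=> Up XS YS; rewrite (curvature_frame Up XS YS nabla_V1).
rewrite (dnabla_tensor LC)//; [|exact: frame_smooth|by move=> *; exact: tau1_smooth].
rewrite !nabla_V1//.
by apply: tangent_ext => f _; rewrite !tangentE; ring.
Qed.

Lemma curvature_V2 p X Y : U p -> vsmooth_at X p -> vsmooth_at Y p ->
  curvature nabla X Y (V 2) p = (2 * d1 tau2 X Y p) *: V 2 p.
Proof.
move=> Up XS YS; rewrite (curvature_frame Up XS YS nabla_V2).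
rewrite (dnabla_tensor LC)//; [|exact: frame_smooth|by move=> *; exact: tau2_smooth].
rewrite !nabla_V2//.
by apply: tangent_ext => f _; rewrite !tangentE; ring.
Qed.

Lemma d1_theta1 p X Y : U p -> vsmooth_at X p -> vsmooth_at Y p ->
  2 * d1 (theta 1) X Y p =
  tau1 p (X p) * theta 1 p (Y p) - tau1 p (Y p) * theta 1 p (X p).
Proof.
move=> Up XS YS; have FS := @frame_smooth p^~ Up.
by rewrite (d1_dual_form LC)// !nabla_V1// !(metricE PR).
Qed.

Lemma d1_theta2 p X Y : U p -> vsmooth_at X p -> vsmooth_at Y p ->
  2 * d1 (theta 2) X Y p =
  tau2 p (X p) * theta 2 p (Y p) - tau2 p (Y p) * theta 2 p (X p).
Proof.
move=> Up XS YS; have FS := @frame_smooth p^~ Up.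
by rewrite (d1_dual_form LC)// !nabla_V2// !(metricE PR).
Qed.

Lemma phi_xi0 p : phi p (xi p) = 0.
Proof.
have [[[_ _ phi2 eta1 _] _ _] _] := WPC.
have ff0 : phi p (phi p (xi p)) = 0.
  by rewrite phi2 eta1 scale1r subrr.
have := phi2 p (phi p (xi p)); rewrite ff0 raddf0 => /esym/subr0_eq.
move: (eta p _) => c e; move: ff0; rewrite e linearZ /= e scalerA => /eqP.
rewrite scaler_eq0 mulf_eq0 orbb => /orP[/eqP ->|/eqP ->];
  by rewrite ?scale0r ?scaler0.
Qed.

Lemma curvature_V0_decomp p X Y : U p -> vsmooth_at X p -> vsmooth_at Y p ->
  curvature nabla X Y (V 0) p =
  (-2 * (tau1 p (X p) * theta 1 p (Y p) - tau1 p (Y p) * theta 1 p (X p)))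
    *: V 1 p +
  (-2 * sigma *
    (tau2 p (X p) * theta 2 p (Y p) - tau2 p (Y p) * theta 2 p (X p)))
    *: V 2 p.
Proof.
move=> Up XS YS; rewrite (curvature_frame Up XS YS nabla_V0).
rewrite (dnabla_comb LC)// ?(dnablaZ LC)//;
  try by move=> Z ZS; try apply: vsmoothZ (smooth_at_cst _ _) _;
         exact: tensor_smooth Up (theta_smooth _ Up ZS).
rewrite !(dnabla_tensor LC)//; try by move=> *; exact: theta_smooth.
  2-3: exact: frame_smooth.
rewrite d1_theta1// d1_theta2// !nabla_V1// !nabla_V2//.
by apply: tangent_ext => f _; rewrite !tangentE /theta; ring.
Qed.

(* The commutation of R(X, Y) with phi, applied to xi, forces R(X, Y) xi to be
   a multiple of xi. *)
Lemma curvature_V0_xi p X Y : U p -> vsmooth_at X p -> vsmooth_at Y p ->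
  exists c : R, curvature nabla X Y (V 0) p = c *: V 0 p.
Proof.
move=> Up XS YS; have [[[SM _ phi2 _ _] _ _] W] := WPC.
have xiS : vsmooth_at xi p by case: SM.
have V0xi : \forall q \near p, V 0 q = xi q.
  by apply: filterS (near_domain Up) => q; case: AF => _ + _ _ _; exact.
have := W p X Y xi XS YS xiS.
rewrite (_ : (fun q => phi q (xi q)) = (fun=> 0)); last first.
  by apply: functional_extensionality_dep => q; exact: phi_xi0.
rewrite (curvature0 LC)// => /esym phiR0.
have := phi2 p (curvature nabla X Y xi p); rewrite phiR0 raddf0.
move=> /esym/subr0_eq RE; exists (eta p (curvature nabla X Y xi p)).
rewrite (curvature_near LC _ _ _ V0xi)//; last exact: frame_smooth.
by rewrite (nbhs_singleton V0xi).
Qed.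

Lemma tau1_theta1 p X Y : U p -> vsmooth_at X p -> vsmooth_at Y p ->
  tau1 p (X p) * theta 1 p (Y p) = tau1 p (Y p) * theta 1 p (X p).
Proof.
move=> Up XS YS; have [c] := curvature_V0_xi Up XS YS.
rewrite curvature_V0_decomp// => /(congr1 (fun v => g p v (V 3 p))).
rewrite !(metricE PR) !(frame_metricE Up) !(mulr0, mulr1, addr0) => /eqP.
by rewrite mulf_eq0 oppr_eq0 pnatr_eq0 /= subr_eq0 => /eqP.
Qed.

Lemma tau2_theta2 p X Y : U p -> vsmooth_at X p -> vsmooth_at Y p ->
  tau2 p (X p) * theta 2 p (Y p) = tau2 p (Y p) * theta 2 p (X p).
Proof.
move=> Up XS YS; have [c] := curvature_V0_xi Up XS YS.
rewrite curvature_V0_decomp// => /(congr1 (fun v => g p v (V 4 p))).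
rewrite !(metricE PR) !(frame_metricE Up) !(mulr0, mulr1, add0r) => /eqP.
by rewrite !mulf_eq0 oppr_eq0 pnatr_eq0 (negbTE sigma0) /= subr_eq0 => /eqP.
Qed.

Lemma curvature_V0 p X Y : U p -> vsmooth_at X p -> vsmooth_at Y p ->
  curvature nabla X Y (V 0) p = 0.
Proof.
move=> Up XS YS; rewrite curvature_V0_decomp// tau1_theta1// tau2_theta2//.
by rewrite !subrr !mulr0 !scale0r addr0.
Qed.

Lemma DomegaE p X Y :
  2 * D X Y p = 2 * d1 omega X Y p
    - (omega p (X p) * (tau1 p (Y p) + tau2 p (Y p))
       - omega p (Y p) * (tau1 p (X p) + tau2 p (X p))).
Proof. by rewrite /D /Domega /wedge11 /add_oneform /=; field. Qed.

Lemma curvature_V3 p X Y : U p -> vsmooth_at X p -> vsmooth_at Y p ->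
  curvature nabla X Y (V 3) p =
  theta 1 p (X p) *: shape_op xi nabla Y p
  - theta 1 p (Y p) *: shape_op xi nabla X p
  + (2 * D X Y p) *: V 2 p - (2 * d1 tau1 X Y p) *: V 3 p.
Proof.
move=> Up XS YS; rewrite (curvature_frame Up XS YS nabla_V3).
have T1 Z (ZS : vsmooth_at Z p) := tensor_smooth 0 Up (theta_smooth 1 Up ZS).
have T2 Z (ZS : vsmooth_at Z p) := tensor_smooth 2 Up (omega_smooth Up ZS).
have T3 Z (ZS : vsmooth_at Z p) := tensor_smooth 3 Up (tau1_smooth Up ZS).
have T3' Z (ZS : vsmooth_at Z p) := vsmoothZ (smooth_at_cst p (-1)) (T3 Z ZS).
have T23 Z (ZS : vsmooth_at Z p) := vsmooth_comb 1 (T2 Z ZS) (T3' Z ZS).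
rewrite 2?(dnabla_comb LC)// (dnablaZ LC)//.
have FS i := frame_smooth i Up.
rewrite !(dnabla_tensor LC)//; last first.
- by move=> *; exact: theta_smooth.
- by move=> *; exact: omega_smooth.
- by move=> *; exact: tau1_smooth.
rewrite -/(theta 1) d1_theta1// tau1_theta1// subrr DomegaE.
rewrite !shape_opE// !nabla_V0// !nabla_V2// !nabla_V3//.
rewrite /dual_form !(metricC PR (X p)) !(metricC PR (Y p)).
have := tau1_theta1 Up XS YS; rewrite /theta /dual_form => tt.
apply: tangent_ext => f _; rewrite !tangentE; apply/subr0_eq.
transitivity ((tau1 p (X p) * g p (V 1 p) (Y p)
               - tau1 p (Y p) * g p (V 1 p) (X p)) * V 0 p f); first by ring.
by rewrite tt subrr mul0r.
Qed.

Lemma curvature_V4 p X Y : U p -> vsmooth_at X p -> vsmooth_at Y p ->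
  curvature nabla X Y (V 4) p =
  (sigma * theta 2 p (X p)) *: shape_op xi nabla Y p
  - (sigma * theta 2 p (Y p)) *: shape_op xi nabla X p
  - (2 * D X Y p) *: V 1 p - (2 * d1 tau2 X Y p) *: V 4 p.
Proof.
move=> Up XS YS; rewrite (curvature_frame Up XS YS nabla_V4).
have T1 Z (ZS : vsmooth_at Z p) := tensor_smooth 0 Up (theta_smooth 2 Up ZS).
have T2 Z (ZS : vsmooth_at Z p) := tensor_smooth 1 Up (omega_smooth Up ZS).
have T3 Z (ZS : vsmooth_at Z p) := tensor_smooth 4 Up (tau2_smooth Up ZS).
have T3' Z (ZS : vsmooth_at Z p) := vsmoothZ (smooth_at_cst p (-1)) (T3 Z ZS).
have T23 Z (ZS : vsmooth_at Z p) := vsmooth_comb (-1) (T2 Z ZS) (T3' Z ZS).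
rewrite 2?(dnabla_comb LC)// (dnablaZ LC)//.
have FS i := frame_smooth i Up.
rewrite !(dnabla_tensor LC)//; last first.
- by move=> *; exact: theta_smooth.
- by move=> *; exact: omega_smooth.
- by move=> *; exact: tau2_smooth.
rewrite -/(theta 2) d1_theta2// tau2_theta2// subrr DomegaE.
rewrite !shape_opE// !nabla_V0// !nabla_V1// !nabla_V4//.
rewrite /dual_form !(metricC PR (X p)) !(metricC PR (Y p)).
have := tau2_theta2 Up XS YS; rewrite /theta /dual_form => tt.
apply: tangent_ext => f _; rewrite !tangentE; apply/subr0_eq.
transitivity (sigma * (tau2 p (X p) * g p (V 2 p) (Y p)
               - tau2 p (Y p) * g p (V 2 p) (X p)) * V 0 p f); first by ring.
by rewrite tt subrr mulr0 mul0r.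
Qed.

Lemma curvature_expand p X Y Z : U p -> vsmooth_at X p -> vsmooth_at Y p ->
  vsmooth_at Z p ->
  curvature nabla X Y Z p =
  theta 0 p (Z p) *: curvature nabla X Y (V 0) p
  + (theta 3 p (Z p) *: curvature nabla X Y (V 1) p
  + (theta 4 p (Z p) *: curvature nabla X Y (V 2) p
  + (theta 1 p (Z p) *: curvature nabla X Y (V 3) p
  + theta 2 p (Z p) *: curvature nabla X Y (V 4) p))).
Proof.
move=> Up XS YS ZS; have FS i := frame_smooth i Up.
have TS i := theta_smooth i Up ZS.
have S4 := tensor_smooth 4 Up (TS 2).
have S3 := vsmooth_lin (TS 1) (FS 3) S4.
have S2 := vsmooth_lin (TS 4) (FS 2) S3.
have S1 := vsmooth_lin (TS 3) (FS 1) S2.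
rewrite (curvature_near LC XS YS ZS (Z' := fun q =>
  theta 0 q (Z q) *: V 0 q + (theta 3 q (Z q) *: V 1 q
  + (theta 4 q (Z q) *: V 2 q + (theta 1 q (Z q) *: V 3 q
  + theta 2 q (Z q) *: V 4 q))))); last first.
  apply: filterS (near_domain Up) => q Uq.
  by rewrite {1}(frame_expand (Z q) Uq) -!addrA.
rewrite !(curvature_lin LC)//; do 4!congr (_ + _).
by rewrite (curvatureZ LC).
Qed.

Lemma curvature4E p X Y Z W : U p -> vsmooth_at X p -> vsmooth_at Y p ->
  vsmooth_at Z p ->
  let A := shape_op xi nabla in
  curvature4 g nabla X Y Z W p =
       g p (A X p) (Z p) * g p (A Y p) (W p)
       - g p (A Y p) (Z p) * g p (A X p) (W p)
       - 2 * d1 tau1 X Y p * Theta g V 1 3 Z W p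
       - 2 * d1 tau2 X Y p * Theta g V 2 4 Z W p
       + 2 * D X Y p * Theta g V 1 2 Z W p.
Proof.
move=> Up XS YS ZS A; rewrite /curvature4 curvature_expand//.
rewrite curvature_V0// curvature_V1// curvature_V2// curvature_V3// curvature_V4//.
rewrite scaler0 add0r -/A.
have AE B E : vsmooth_at B p -> g p (A B p) (E p) =
    theta 1 p (B p) * theta 1 p (E p) + sigma * theta 2 p (B p) * theta 2 p (E p).
  by move=> BS; rewrite /A shape_opE// !(metricE PR) /theta /dual_form
    !(metricC PR (B p)).
clearbody A; rewrite !(metricE PR) !AE// /Theta /wedge11 /theta /dual_form.
by field.
Qed.

Lemma bianchi1_curvature4 p X Y Z W : vsmooth_at X p -> vsmooth_at Y p ->
  vsmooth_at Z p ->
  curvature4 g nabla X Y Z W p + curvature4 g nabla Y Z X W p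
  + curvature4 g nabla Z X Y W p = 0.
Proof.
move=> XS YS ZS; rewrite /curvature4 -!(metricDl PR) (bianchi1 LC)//.
by rewrite (metricC PR) (metric0r g).
Qed.

(* The shape operator terms drop out of the cyclic sum because A is
   self-adjoint. *)
Lemma bianchi1_forms p X Y Z W : U p -> vsmooth_at X p -> vsmooth_at Y p ->
  vsmooth_at Z p ->
  wedge21 (d1 tau1) (theta 1) X Y Z p * theta 3 p (W p)
  - wedge21 (d1 tau1) (theta 3) X Y Z p * theta 1 p (W p)
  + wedge21 (d1 tau2) (theta 2) X Y Z p * theta 4 p (W p)
  - wedge21 (d1 tau2) (theta 4) X Y Z p * theta 2 p (W p)
  - wedge21 D (theta 1) X Y Z p * theta 2 p (W p)
  + wedge21 D (theta 2) X Y Z p * theta 1 p (W p) = 0.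
Proof.
move=> Up XS YS ZS; have := bianchi1_curvature4 W XS YS ZS.
rewrite !curvature4E// !shape_opE// !(metricE PR).
rewrite /Theta /wedge11 /wedge21 /theta /dual_form.
rewrite !(metricC PR (X p)) !(metricC PR (Y p)) !(metricC PR (Z p)).
move=> B; apply: (@mulfI _ (-6)); first by rewrite oppr_eq0 pnatr_eq0.
by rewrite mulr0 -[RHS]B; field.
Qed.

End Frame.

Theorem proposition6 (R : realType) (M : smoothManifold R 5)
    (phi : endofield M) (xi : vfield M) (eta : oneform M) (g : bilinfield M)
    (nabla : connection (M := M)) (sigma : R)
    (U : set M) (V : 'I_5 -> vfield M) (tau1 tau2 omega : oneform M) :
  levi_civita g nabla ->
  weakly_para_cosymplectic phi xi eta g nabla ->
  para_kahler_leaves phi eta g ->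
  (sigma = 1 /\ elliptic phi xi g nabla \/
   sigma = -1 /\ hyperbolic phi xi g nabla) ->
  open U ->
  adopted_frame phi xi g nabla sigma U V ->
  associated_forms g nabla U V tau1 tau2 omega ->
  let A := shape_op xi nabla in
  let theta i := dual_form g (V i) in
  let D := Domega tau1 tau2 omega in
  (forall (p : M) (X Y Z W : vfield M), U p ->
     vsmooth_at X p -> vsmooth_at Y p -> vsmooth_at Z p -> vsmooth_at W p ->
     curvature4 g nabla X Y Z W p =
       g p (A X p) (Z p) * g p (A Y p) (W p)
       - g p (A Y p) (Z p) * g p (A X p) (W p)
       - 2 * d1 tau1 X Y p * Theta g V 1 3 Z W p
       - 2 * d1 tau2 X Y p * Theta g V 2 4 Z W p
       + 2 * D X Y p * Theta g V 1 2 Z W p) /\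
  (forall (p : M) (X Y Z : vfield M), U p ->
     vsmooth_at X p -> vsmooth_at Y p -> vsmooth_at Z p ->
     [/\ wedge21 (d1 tau1) (theta 1) X Y Z p = 0,
         wedge21 (d1 tau2) (theta 2) X Y Z p = 0,
         wedge21 (d1 tau1) (theta 3) X Y Z p = wedge21 D (theta 2) X Y Z p &
         wedge21 (d1 tau2) (theta 4) X Y Z p = - wedge21 D (theta 1) X Y Z p]).
Proof.
move=> LC WPC _ sigma1 oU AF TF A theta D.
have sigma0 : sigma != 0.
  by case: sigma1 => -[-> _]; rewrite ?oppr_eq0 oner_eq0.
split=> [p X Y Z W Up XS YS ZS _|p X Y Z Up XS YS ZS].
  exact: (curvature4E LC WPC oU AF TF sigma0).
have B i := bianchi1_forms LC WPC oU AF TF sigma0 (V i) Up XS YS ZS.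
move: (B 1) (B 2) (B 3) (B 4); rewrite -/D /= /dual_form !(frame_metricE AF Up).
rewrite !(mulr0, mulr1, subr0, addr0, add0r, sub0r) => B1 B2 B3 B4.
split=> //.
- by apply/subr0_eq/eqP; rewrite -oppr_eq0 opprB addrC; apply/eqP.
- by apply/subr0_eq/eqP; rewrite opprK -oppr_eq0 opprD; apply/eqP.
Qed.
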